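(* Let $a_0,\lambda>0$, $z_0\in(0,1)$, $a(z)=a_0e^{-z/\lambda}$ and $f(\varphi)=\varphi(\varphi-1)$. For $\varphi_o\in[0,1]$, let $(z(t),\varphi(t))$ be the characteristic of $\varphi_t+(a(z)f(\varphi))_z=0$ with initial values $z(0)=z_0$, $\varphi(0)=\varphi_o$. Then the centered rarefaction wave formed by this fan of characteristics is given explicitly as follows: for every $\varphi_o\in[0,1]$ and every $t>0$ such that the characteristic stays in $0\le z\le 1$ on $[0,t]$, with $z=z(t)$ one has $$\varphi_o=\varphi_o(z,t)=\frac{\lambda}{2a_0t}\left(\frac{a_0t}{\lambda}-2e^{z_0/\lambda}+\sqrt{4e^{(z+z_0)/\lambda}+\left(\frac{a_0t}{\lambda}\right)^2}\right)$$ and $$\varphi(t)=\varphi(z,t)=\varphi_o(z,t)-\frac{a_0}{\lambda}\,t\,\varphi_o(z,t)\bigl(1-\varphi_o(z,t)\bigr)e^{-z_0/\lambda}.$$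
   Context: The characteristics of the conservation law $\varphi_t+(a(z)f(\varphi))_z=0$ are the curves $(z(t),\varphi(t))$ solving $$\frac{dz}{dt}=a(z)f'(\varphi),\qquad \frac{d\varphi}{dt}=-a'(z)f(\varphi).$$ The rarefaction wave centered at $(z,t)=(z_0,0)$ is the function whose value at a point $(z(t),t)$ of the characteristic starting at $z(0)=z_0$, $\varphi(0)=\varphi_o$ is $\varphi(t)$, with $\varphi_o$ ranging over $[0,1]$. *)

(* Defs.v *)
From Stdlib Require Import Reals.
From Coquelicot Require Import Coquelicot.
Open Scope R_scope.

(* [(z, phi)] is a characteristic of phi_t + (a(z) f(phi))_z = 0 on the time
   interval [0, T].  [D_in] is the derivative within the interval, so it is
   one-sided at 0 and T, and values outside [0, T] play no role. *)
Definition is_characteristic (a f : R -> R) (T : R) (z phi : R -> R) : Prop :=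
  forall t : R, 0 <= t <= T ->
    D_in z (fun s => a (z s) * Derive f (phi s)) (fun s => 0 <= s <= T) t /\
    D_in phi (fun s => - Derive a (z s) * f (phi s)) (fun s => 0 <= s <= T) t.

Definition fan_characteristic (a f : R -> R) (z0 phi0 T : R)
    (z phi : R -> R) : Prop :=
  is_characteristic a f T z phi /\
  z 0 = z0 /\ phi 0 = phi0 /\
  (forall s : R, 0 <= s <= T -> 0 <= z s <= 1).

(* The wave takes the value phi(t) at the point (z(t), t) of each characteristic
   of the fan.  Time 0 is excluded: there the whole fan sits at the single point
   (z0, 0).  Nothing is required of [u] off the fan. *)
Definition is_centered_rarefaction (a f : R -> R) (z0 : R)
    (u : R -> R -> R) : Prop :=
  forall (phi0 t : R) (z phi : R -> R),
    0 <= phi0 <= 1 -> 0 < t ->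
    fan_characteristic a f z0 phi0 t z phi ->
    u (z t) t = phi t.

(* Main.v *)
Require Import Defs.
From Stdlib Require Import Reals Lra.
From Coquelicot Require Import Coquelicot.
Open Scope R_scope.

(** Along any characteristic the flux [a(z) f(phi)] is conserved: the two
    contributions [a' z' f] and [a f' phi'] cancel.  For an exponential [a] one
    has [- a' = a / lambda], so [phi'] is the conserved flux divided by
    [lambda], hence constant, and [phi] is affine in time.  The second
    ingredient is the substitution [E = exp (z / lambda)], which turns the
    equation for [z] into [E' = (a0 / lambda) (2 phi - 1)]; as [phi] is affine,
    [E] is a quadratic polynomial in time.  With [s = a0 t / lambda] and
    [E0 = exp (z0 / lambda)] this quadratic factors as
    [E E0 = (E0 + s phi0) (E0 + s (phi0 - 1))].

    Completing the square, [(2 E0 + s (2 phi0 - 1))^2 = 4 E E0 + s^2], and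
    solving for [phi0] gives the stated formula provided the left-hand base is
    nonnegative.  It is: the product [E E0] of the two factors and the first
    factor are positive, so the second factor is positive too, and the base is
    their sum. *)

(** * Calculus of derivatives within a set *)

(** Derivatives at the endpoints are one-sided, which the mean value theorem
    does not accept.  Precomposing with the projection of the line onto
    [[0, T]] makes the function continuous at the endpoints and does not
    change it inside. *)
Lemma D_in_zero_constant (F d : R -> R) (T : R) :
  (forall t, 0 <= t <= T -> D_in F d (fun s => 0 <= s <= T) t) ->
  (forall t, 0 <= t <= T -> d t = 0) ->
  forall t, 0 <= t <= T -> F t = F 0.
Proof.
  intros HF Hd t Ht.
  set (p := fun x => Rmax 0 (Rmin T x)).
  assert (p_id : forall x, 0 <= x <= T -> p x = x).
  { intros x Hx; unfold p, Rmax, Rmin.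
    destruct (Rle_dec T x); destruct (Rle_dec 0 _); lra. }
  assert (p_in : forall x, 0 <= p x <= T).
  { intros x; unfold p, Rmax, Rmin.
    destruct (Rle_dec T x); destruct (Rle_dec 0 _); lra. }
  assert (p_lip : forall x y, 0 <= y <= T -> Rabs (p x - y) <= Rabs (x - y)).
  { intros x y Hy; unfold p, Rmax, Rmin.
    destruct (Rle_dec T x); destruct (Rle_dec 0 _);
      unfold Rabs; repeat destruct Rcase_abs; lra. }
  destruct (MVT_gen (fun x => F (p x)) 0 t d) as [c [Hc E]];
    rewrite ?Rmin_left, ?Rmax_right in * by lra.
  - intros x Hx. apply is_derive_Reals. intros eps Heps.
    destruct (HF x ltac:(lra) eps Heps) as [alp [Halp H]].
    assert (Hm : 0 < Rmin alp (Rmin x (T - x))) by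
      (repeat apply Rmin_pos; lra).
    exists (mkposreal _ Hm). intros h Hh Hlt; simpl in Hlt.
    pose proof (Rmin_l alp (Rmin x (T - x))).
    pose proof (Rmin_r alp (Rmin x (T - x))).
    pose proof (Rmin_l x (T - x)). pose proof (Rmin_r x (T - x)).
    assert (Hh' : - Rmin alp (Rmin x (T - x)) < h
                    < Rmin alp (Rmin x (T - x))) by
      (now apply Rabs_def2 in Hlt; lra).
    rewrite !p_id by lra.
    specialize (H (x + h)). simpl in H; unfold Rdist in H.
    replace (x + h - x) with h in H by ring.
    apply H. repeat split; lra.
  - intros x Hx eps Heps.
    destruct (cont_deriv _ _ _ _ (HF x ltac:(lra)) eps Heps) as [alp [Halp H]].
    exists alp; split; [exact Halp|]. intros y [_ Hy].
    simpl in *; unfold Rdist in *.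
    rewrite (p_id x) by lra.
    destruct (Req_dec (p y) x) as [->|Hne].
    { rewrite Rminus_diag, Rabs_R0; lra. }
    apply H; repeat split; try apply p_in; try lra.
    apply Rle_lt_trans with (2 := Hy), p_lip; lra.
  - rewrite !p_id in E by lra. rewrite Hd in E by lra. lra.
Qed.

Lemma D_in_comp (G F d : R -> R) (l : R) (D : R -> Prop) (x : R) :
  is_derive G (F x) l -> D_in F d D x ->
  D_in (fun s => G (F s)) (fun s => d s * l) D x.
Proof.
  intros HG HF.
  apply is_derive_Reals in HG.
  apply (derivable_pt_lim_D_in G (fun _ => l)) in HG.
  apply D_in_imp with (2 := Dcomp _ _ _ _ _ _ _ HF HG).
  now intros s Hs; split.
Qed.

(** * Characteristics *)

Lemma characteristic_flux_constant (a f : R -> R) (T : R) (z phi : R -> R) :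
  (forall x, ex_derive a x) -> (forall x, ex_derive f x) ->
  is_characteristic a f T z phi ->
  forall t, 0 <= t <= T -> a (z t) * f (phi t) = a (z 0) * f (phi 0).
Proof.
  intros Ha Hf H.
  apply (D_in_zero_constant (fun s => a (z s) * f (phi s))
    (fun s => a (z s) * Derive f (phi s) * Derive a (z s) * f (phi s) +
              a (z s) * (- Derive a (z s) * f (phi s) * Derive f (phi s)))).
  - intros t Ht; destruct (H t Ht) as [Hz Hphi].
    exact (Dmult _ _ _ _ _ _
      (D_in_comp a z _ _ _ _ (Derive_correct _ _ (Ha (z t))) Hz)
      (D_in_comp f phi _ _ _ _ (Derive_correct _ _ (Hf (phi t))) Hphi)).
  - intros t _; ring.
Qed.

Section Exponential.

Variables a0 lambda : R.
Hypothesis lambda_pos : 0 < lambda.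

Let a (z : R) := a0 * exp (- z / lambda).
Let f (phi : R) := phi * (phi - 1).

Lemma is_derive_exponential_coefficient (x : R) :
  is_derive a x (- a x / lambda).
Proof. unfold a; auto_derive; [exact I | unfold Rdiv; ring]. Qed.

Lemma is_derive_flux (x : R) : is_derive f x (2 * x - 1).
Proof. unfold f; auto_derive; [exact I | ring]. Qed.

Lemma exponential_characteristic_affine (T : R) (z phi : R -> R) :
  is_characteristic a f T z phi ->
  forall t, 0 <= t <= T ->
    phi t = phi 0 + a (z 0) * f (phi 0) / lambda * t.
Proof.
  intros H t Ht.
  set (k := a (z 0) * f (phi 0) / lambda).
  assert (E : phi t - k * t = phi 0 - k * 0); [|lra].
  apply (D_in_zero_constant (fun s => phi s - k * s)
    (fun s => - Derive a (z s) * f (phi s) - k * 1) T); [| |exact Ht].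
  - intros s Hs. apply Dminus; [apply (H s Hs)|].
    exact (Dmult_const _ (fun x => x) _ _ k (Dx _ s)).
  - intros s Hs.
    rewrite (is_derive_unique _ _ _ (is_derive_exponential_coefficient (z s))).
    unfold k.
    rewrite <- (characteristic_flux_constant a f T z phi) with (t := s);
      trivial.
    + field; lra.
    + intros x; eexists; apply is_derive_exponential_coefficient.
    + intros x; eexists; apply is_derive_flux.
Qed.

(** In the variable [exp (z / lambda)] the factor [a (z)] of the velocity
    disappears, leaving a velocity that is affine in time. *)
Lemma exponential_characteristic_quadratic (T : R) (z phi : R -> R) :
  is_characteristic a f T z phi ->
  forall t, 0 <= t <= T ->
    exp (z t / lambda) =
      exp (z 0 / lambda) +
      a0 / lambda * ((2 * phi 0 - 1) * t + a (z 0) * f (phi 0) / lambda * t ^ 2).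
Proof.
  intros H t Ht.
  set (k := a (z 0) * f (phi 0) / lambda).
  set (Q := fun s => a0 / lambda * ((2 * phi 0 - 1) * s + k * s ^ 2)).
  set (G := fun x => exp (x / lambda)).
  set (q := fun s => a0 / lambda * (2 * phi 0 - 1 + 2 * k * s)).
  assert (E : G (z t) - Q t = G (z 0) - Q 0).
  2:{ unfold G, Q in E. rewrite Rmult_0_r in E. lra. }
  (* [D_in] sees its derivative function only through the value at the point,
     so it suffices that the derivative computed below vanishes at [s]. *)
  apply (D_in_zero_constant (fun s => G (z s) - Q s) (fun _ => 0) T);
    [|reflexivity|exact Ht].
  intros s Hs.
  assert (HG : is_derive G (z s) (exp (z s / lambda) / lambda)).
  { unfold G; auto_derive; [exact I | unfold Rdiv; ring]. }
  assert (HQ : is_derive Q s (q s)).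
  { unfold Q, q; auto_derive; [exact I | ring]. }
  pose proof (Dminus _ _ _ _ _ _
    (D_in_comp G z _ _ _ _ HG (proj1 (H s Hs)))
    (D_in_comp Q (fun x => x) _ _ _ _ HQ (Dx _ s))) as HD.
  unfold D_in in HD |- *; cbv beta in HD.
  rewrite (is_derive_unique _ _ _ (is_derive_flux (phi s))) in HD.
  match type of HD with limit1_in _ _ ?v _ => replace v with 0 in HD end;
    [exact HD|].
  rewrite (exponential_characteristic_affine T z phi H s Hs); fold k.
  unfold a, q.
  replace (- z s / lambda) with (- (z s / lambda)) by (field; lra).
  rewrite exp_Ropp.
  pose proof (exp_pos (z s / lambda)). field; lra.
Qed.

End Exponential.

(** * Inverting the fan *)

(** The hypothesis is [E E0 = (E0 + s x) (E0 + s (x - 1))]; positivity of [E]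
    selects the root. *)
Lemma fan_quadratic_inversion (E E0 s x : R) :
  0 < E -> 0 < E0 -> 0 < s -> 0 <= x ->
  E * E0 = E0 ^ 2 + s * (2 * x - 1) * E0 + s ^ 2 * (x * (x - 1)) ->
  x = / (2 * s) * (s - 2 * E0 + sqrt (4 * (E * E0) + s ^ 2)).
Proof.
  intros HE HE0 Hs Hx H.
  assert (P1 : 0 < E0 + s * x) by nra.
  assert (P2 : 0 < E0 + s * (x - 1)).
  { apply Rmult_lt_reg_l with (E0 + s * x); [exact P1|].
    pose proof (Rmult_lt_0_compat _ _ HE HE0). nra. }
  replace (4 * (E * E0) + s ^ 2) with ((2 * E0 + s * (2 * x - 1)) ^ 2)
    by (rewrite H; ring).
  rewrite sqrt_pow2 by lra.
  field; lra.
Qed.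

Theorem mainTheorem2 (a0 lambda z0 : R) (ha0 : 0 < a0) (hlambda : 0 < lambda)
    (hz0 : 0 < z0 < 1) :
  let a := fun z : R => a0 * exp (- z / lambda) in
  let f := fun phi : R => phi * (phi - 1) in
  let phi_o := fun z t : R =>
    lambda / (2 * a0 * t) *
      (a0 * t / lambda - 2 * exp (z0 / lambda) +
       sqrt (4 * exp ((z + z0) / lambda) + (a0 * t / lambda) ^ 2)) in
  let phi_w := fun z t : R =>
    phi_o z t -
      a0 / lambda * t * phi_o z t * (1 - phi_o z t) * exp (- z0 / lambda) in
  is_centered_rarefaction a f z0 phi_w /\
  (forall (phi0 t : R) (z phi : R -> R),
     0 <= phi0 <= 1 -> 0 < t ->
     fan_characteristic a f z0 phi0 t z phi ->
     phi0 = phi_o (z t) t /\ phi t = phi_w (z t) t).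
Proof.
  intros a f phi_o phi_w.
  assert (main : forall (phi0 t : R) (z phi : R -> R),
     0 <= phi0 <= 1 -> 0 < t ->
     fan_characteristic a f z0 phi0 t z phi ->
     phi0 = phi_o (z t) t /\ phi t = phi_w (z t) t).
  { intros phi0 t z phi Hphi0 Ht [Hchar [Hz [Hphi _]]].
    assert (Hinv : phi0 = phi_o (z t) t).
    { pose proof (exponential_characteristic_quadratic a0 lambda hlambda
        t z phi Hchar t ltac:(lra)) as Q.
      rewrite Hz, Hphi in Q.
      unfold phi_o.
      replace ((z t + z0) / lambda) with (z t / lambda + z0 / lambda)
        by (field; lra).
      rewrite exp_plus.
      replace (lambda / (2 * a0 * t)) with (/ (2 * (a0 * t / lambda)))
        by (field; lra).
      pose proof (exp_pos (z0 / lambda)).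
      apply fan_quadratic_inversion; try apply exp_pos; try lra.
      - apply Rdiv_lt_0_compat; nra.
      - rewrite Q.
        replace (- z0 / lambda) with (- (z0 / lambda)) by (field; lra).
        rewrite exp_Ropp. field; lra. }
    split; [exact Hinv|].
    unfold phi_w; rewrite <- Hinv.
    rewrite (exponential_characteristic_affine a0 lambda hlambda
      t z phi Hchar t) by lra.
    rewrite Hz, Hphi. field; lra. }
  split; [|exact main].
  intros phi0 t z phi Hphi0 Ht H.
  symmetry; exact (proj2 (main phi0 t z phi Hphi0 Ht H)).
Qed.
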